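(* Let $n\ge 1$ and let $T_n$ be a polynomial of degree $n$ with complex coefficients. The inverse image $T_n^{-1}([-1,1])$ is connected if and only if all zeros of the derivative $T_n'$ lie in $T_n^{-1}([-1,1])$.
   Context: For a polynomial $T_n$, $T_n^{-1}([-1,1]):=\{z\in\mathbb{C}: T_n(z)\in[-1,1]\}$. Zeros are complex zeros. *)

(* Defs.v *)
From HB Require Import structures.
From mathcomp Require Export all_boot all_order all_algebra complex.
From mathcomp Require Export all_classical all_reals all_analysis.
Export Order.TTheory GRing.Theory Num.Theory numFieldNormedType.Exports.

#[export] Set Implicit Arguments.
#[export] Unset Strict Implicit.
#[export] Unset Printing Implicit Defensive.

Local Open Scope classical_set_scope.
Local Open Scope ring_scope.
Local Open Scope complex_scope.

(* The complex plane is [R[i]^o]: a bare [R[i]] carries no canonical topology,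
   whereas the regular module [R[i]^o] has the one of the complex modulus. *)

Definition real_segment (R : realType) : set R[i] :=
  [set r%:C | r in `[(-1 : R), 1]].

Definition inverse_image (R : realType) (T : {poly R[i]}) : set R[i]^o :=
  (fun z : R[i]^o => T.[z]) @^-1` @real_segment R.

(* Main.v *)
Require Import Defs.
From mathcomp Require Import ring lra zify.
Import Normc.

Local Open Scope classical_set_scope.
Local Open Scope ring_scope.
Local Open Scope complex_scope.

(** Write [K] for the inverse image of the segment.

Critical points in [K] force connectedness, by a mountain pass argument.  The
sum [G z = |T z - 1| + |T z + 1|] of the distances from [T z] to the foci [-1]
and [1] is at least 2, with equality exactly on [K], and its sublevel sets are
compact.  If [K] splits into two closed pieces, points [a] and [b] taken from
the two pieces can be joined by a continuum inside [{G < c}] when [c] is large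
but not when [c] is close to 2, so there is a critical level [m > 2].  At a
point [p] with [G p > 2] and [T' p <> 0] one can move [z] so that [T z] moves
straight towards 0, and since [G] is a convex function of [T z] with value 2 at
0, it decreases at a definite rate near [p] ([focal_sum_descent]).  Hence
[{G < m}] is locally connected at its boundary ([joined_locally]).  If [a] and
[b] were not joined below [m], the points of [{G < m}] joined to [a] and the
others would have disjoint closures covering [{G <= m}], so [a] and [b] would
still be separated slightly above [m] ([joined_limit]); and if they are joined
below [m], compactness joins them below some smaller level.  Both contradict
the choice of [m].

Connectedness forces the critical points into [K], by counting components, in
the spirit of the Riemann-Hurwitz formula.  Let [K_t] be the part of [K] over
[[-1, t]].  Over a short interval around [w] the inverse image falls apart into
clusters, one for each distinct root of [T - w].  When [t] crosses [w], these
clusters are glued to the components already present along a fiber of at most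
[n] points, so at most [n - #T^-1(w)] components are lost, and this is at most
the number of critical points over [w].  Hence [K_t] has at least [n] minus the
number of critical points in [K_t] components ([many_components_segment]).  For
a connected [K] this leaves at least [n - 1] critical points in [K], which are
all of them.  Components are counted linearly, through locally constant maps to
a vector space whose values span it: gluing then passes to a quotient, and the
count is a rank inequality ([glue_spanning]). *)

(** * The modulus of complex numbers *)

Section Modulus.
Variable R : realType.
Implicit Types (x y z : R[i]).

Lemma normc_ge0 z : 0 <= normc z.
Proof. by case: z => a b /=; exact: sqrtr_ge0. Qed.

Lemma normrE z : `|z| = (normc z)%:C.
Proof. by case: z. Qed.

Lemma normc_real (r : R) : normc r%:C = `|r|.
Proof. by rewrite /= expr0n addr0 sqrtr_sqr. Qed.

Lemma normcD x y : normc (x + y) <= normc x + normc y.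
Proof. exact: le_normcD. Qed.

Lemma normc_opp x : normc (- x) = normc x.
Proof. exact: normcN. Qed.

Lemma normcB x y : normc (x - y) = normc (y - x).
Proof. by rewrite -normc_opp opprB. Qed.

Lemma normc_triangle x y z : normc (x - z) <= normc (x - y) + normc (y - z).
Proof. by rewrite -{1}(subrK y x) -addrA normcD. Qed.

Lemma nbhs_normcP (z : R[i]^o) (A : set R[i]^o) :
  nbhs z A <-> exists2 e : R, 0 < e & forall y, normc (y - z) < e -> A y.
Proof.
split=> [/nbhs_ballP[e /= e0 eA]|[e e0 eA]].
  have /complex_realP[r er] : e \is Num.real by rewrite realE ltW.
  rewrite er in e0 eA; rewrite ltcR in e0; exists r => // y yz; apply: eA.
  by rewrite -ball_normE /ball_ /= normrE ltcR normcB.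
apply/nbhs_ballP; exists e%:C; first by rewrite /= ltcR.
by move=> y; rewrite -ball_normE /ball_ /= normrE ltcR normcB => /eA.
Qed.

(** Strict differentiability: both ends of the increment vary, so the estimate
    is uniform in the base point near [p].  Induction on the polynomial reduces
    it to the product rule for multiplication by the variable. *)
Lemma poly_strict_derivative (T : {poly R[i]}) (p : R[i]) (e : R) : 0 < e ->
  exists2 d : R, 0 < d & forall x y, normc (x - p) < d -> normc (y - p) < d ->
    normc (T.[x] - T.[y] - T^`().[p] * (x - y)) <= e * normc (x - y).
Proof.
elim/poly_ind: T e => [|P c IH] e e0.
  exists 1 => // x y _ _; rewrite deriv0 !horner0 mul0r !subr0 normc0.
  by rewrite mulr_ge0 ?normc_ge0 ?ltW.
set k := normc P^`().[p]; set q := normc p + 1.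
have k0 : 0 <= k by exact: normc_ge0.
have q0 : 0 < q by rewrite ltr_wpDl ?normc_ge0.
have e'0 : 0 < Num.min 1 (e / (3 * q)) by rewrite lt_min ltr01 divr_gt0 ?mulr_gt0.
set e' := Num.min 1 _ in e'0.
have [d' d'0 Pd] := IH e' e'0.
have e'1 : e' <= 1 by rewrite /e' ge_min lexx.
have e'q : e' * q <= e / 3.
  rewrite -ler_pdivlMr// (_ : e / 3 / q = e / (3 * q)).
    by rewrite /e' ge_min lexx orbT.
  by field; lra.
have dk : 0 < e / (3 * (k + 1)) by rewrite divr_gt0 ?mulr_gt0//; lra.
exists (Num.min (Num.min 1 d') (e / (3 * (k + 1)))).
  by rewrite !lt_min ltr01 d'0 dk.
set f := e / _ in dk *.
have fk : f * (k + 1) = e / 3 by rewrite /f; field; lra.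
move=> x y; rewrite !lt_min => /andP[/andP[x1 xd] xf] /andP[/andP[y1 yd] yf].
rewrite derivMXaddC !hornerMXaddC hornerD hornerMX.
have -> : P.[x] * x + c - (P.[y] * y + c) - (P.[p] + P^`().[p] * p) * (x - y) =
  ((P.[x] - P.[p] - P^`().[p] * (x - p)) + P^`().[p] * (x - p)
     + P^`().[p] * (y - p)) * (x - y)
  + y * (P.[x] - P.[y] - P^`().[p] * (x - y)) by ring.
have A1 := Pd x y xd yd.
have pd : normc (p - p) < d' by rewrite subrr normc0.
have A2 := Pd x p xd pd.
have yq : normc y <= q.
  by rewrite -[y](subrK p) (le_trans (normcD _ _))// /q; lra.
apply: (le_trans (normcD _ _)); rewrite !normcM.
have n0 := normc_ge0 (x - y).
have B : normc (P.[x] - P.[p] - P^`().[p] * (x - p) + P^`().[p] * (x - p)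
     + P^`().[p] * (y - p)) <= 2 * e / 3.
  apply: (le_trans (normcD _ _)); rewrite normcM -/k.
  have := normcD (P.[x] - P.[p] - P^`().[p] * (x - p)) (P^`().[p] * (x - p)).
  rewrite normcM -/k.
  have xn := normc_ge0 (x - p); have yn := normc_ge0 (y - p).
  have : e' * normc (x - p) <= f by nra.
  have : k * normc (x - p) <= k * f by nra.
  have : k * normc (y - p) <= k * f by nra.
  lra.
have C : normc y * normc (P.[x] - P.[y] - P^`().[p] * (x - y)) <=
    q * (e' * normc (x - y)).
  by rewrite ler_pM ?normc_ge0.
nra.
Qed.

Lemma poly_continuous (T : {poly R[i]}) (p : R[i]) (e : R) : 0 < e ->
  exists2 d : R, 0 < d & forall x, normc (x - p) < d ->
    normc (T.[x] - T.[p]) < e.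
Proof.
move=> e0; have [d d0 Td] := poly_strict_derivative T p ltr01.
set k := normc T^`().[p]; have k0 : 0 <= k by exact: normc_ge0.
have f0 : 0 < e / (k + 2) by rewrite divr_gt0//; lra.
exists (Num.min d (e / (k + 2))); first by rewrite lt_min d0.
move=> x; rewrite lt_min => /andP[xd]; rewrite ltr_pdivlMr; last lra.
have := Td x p xd; rewrite subrr normc0 => /(_ d0).
have := normcD (T.[x] - T.[p] - T^`().[p] * (x - p)) (T^`().[p] * (x - p)).
rewrite subrK normcM -/k; have := normc_ge0 (x - p); nra.
Qed.

Lemma seq_argmin (I : eqType) (f : I -> R) (s : seq I) :
  s != [::] -> exists2 p, p \in s & {in s, forall q, f p <= f q}.
Proof.
elim: s => // a s IH _; have [->|s0] := eqVneq s [::].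
  by exists a; rewrite ?mem_head// => q; rewrite mem_seq1 => /eqP ->.
have [p ps pmin] := IH s0; have [le|lt] := leP (f a) (f p).
  exists a; rewrite ?mem_head// => q; rewrite inE => /predU1P[->//|/pmin].
  exact: le_trans.
exists p; rewrite ?inE ?ps ?orbT// => q /predU1P[->|/pmin//]; exact: ltW.
Qed.

(** [T z - w] is the leading coefficient times the product of the differences
    [z - p] over the roots; the closest root makes every factor large. *)
Lemma root_near_small_value (T : {poly R[i]}) (n : nat) (w z : R[i]) :
  (0 < n)%N -> size T = n.+1 -> exists2 p, T.[p] = w &
    normc (lead_coef T) * normc (z - p) ^+ n <= normc (T.[z] - w).
Proof.
case: n => // n _ sT; set S := T - w%:P.
have sw : (size (- w%:P) < size T)%N.
  by rewrite size_polyN sT (leq_ltn_trans (size_polyC_leq1 _)).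
have sS : size S = n.+2 by rewrite size_polyDl.
have lS : lead_coef S = lead_coef T by rewrite lead_coefDl.
have [r Sr] := closed_field_poly_normal S.
have S0 : S != 0 by rewrite -size_poly_eq0 sS.
have sr : size r = n.+1.
  by move: sS; rewrite Sr size_scale ?lead_coef_eq0// size_prod_XsubC => -[].
have evS x : S.[x] = T.[x] - w by rewrite /S !hornerE.
have val : normc (T.[z] - w) =
    normc (lead_coef T) * \prod_(p <- r) normc (z - p).
  rewrite -evS Sr hornerZ normcM lS; congr (_ * _).
  rewrite horner_prod (big_morph _ (@normcM R) (normc1 R)).
  by apply: eq_bigr => i _; rewrite !hornerE.
have rS p : p \in r -> T.[p] = w.
  move=> pr; apply/eqP; rewrite -subr_eq0 -evS -/(root S p) Sr.
  by rewrite rootZ ?lead_coef_eq0// root_prod_XsubC.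
rewrite {}val.
suff [p pr pz] : exists2 p, p \in r &
    normc (z - p) ^+ n.+1 <= \prod_(p <- r) normc (z - p).
  by exists p; [exact: rS|rewrite ler_wpM2l ?normc_ge0].
have [|p pr pmin] := @seq_argmin _ (fun p => normc (z - p)) r.
  by rewrite -size_eq0 sr.
exists p => //; rewrite -sr -[_ ^+ _]iter_mulr_1 -count_predT -big_const_seq.
rewrite [leRHS]big_seq [leLHS]big_seq.
by apply: ler_prod => q qr; rewrite normc_ge0 pmin.
Qed.

End Modulus.

(** * Fibers and ramification *)

Lemma sum_count_mem_undup (I : eqType) (s t : seq I) :
  (\sum_(p <- undup s) count_mem p t = count [in s] t)%N.
Proof.
under eq_bigr do rewrite -sum1_count big_mkcond.
rewrite exchange_big -sum1_count [RHS]big_mkcond; apply: eq_bigr => z _ /=.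
rewrite -big_mkcond sum1_count (eq_count (a2 := pred1 z)); last first.
  by move=> y /=; rewrite eq_sym.
by rewrite count_uniq_mem ?undup_uniq// mem_undup; case: (z \in s).
Qed.

Lemma dvdp_XsubC_deriv (F : fieldType) (p : F) (S : {poly F}) (k : nat) :
  ('X - p%:P) ^+ k.+1 %| S -> ('X - p%:P) ^+ k %| S^`().
Proof.
move=> /dvdpP[Q ->]; rewrite derivM deriv_exp dvdp_add//.
  by rewrite dvdp_mull// exprS dvdp_mull.
by rewrite dvdp_mull// -mulr_natl mulrC dvdp_mulr// mulrC dvdp_mulr.
Qed.

Section Ramification.
Variables (R : realType) (T : {poly R[i]}) (n : nat).
Hypotheses (hn : (0 < n)%N) (hT : size T = n.+1).

Lemma deriv_neq0 : T^`() != 0.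
Proof.
have : lead_coef T != 0 by rewrite lead_coef_eq0 -size_poly_eq0 hT.
apply: contra_neq => T0; rewrite lead_coefE hT/=.
have := congr1 (fun p : {poly R[i]} => p`_n.-1) T0.
by rewrite coef_deriv coef0 prednK// => /eqP; rewrite mulrn_eq0 gtn_eqF// => /eqP.
Qed.

(** The deficit of distinct points in a fiber is the sum of the multiplicities
    minus one, and each such term is accounted for by a zero of the derivative
    at the same point. *)
Lemma fiber_ramification (cr : seq R[i]) (w : R[i]) :
  T^`() = lead_coef T^`() *: \prod_(z <- cr) ('X - z%:P) ->
  exists r : seq R[i], [/\ uniq r, forall z, (z \in r) = (T.[z] == w),
    (size r <= n)%N & (n <= size r + count (fun z => T.[z] == w) cr)%N].
Proof.
move=> Tcr; set S := T - w%:P.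
have sw : (size (- w%:P) < size T)%N.
  by rewrite size_polyN hT (leq_ltn_trans (size_polyC_leq1 _)).
have sS : size S = n.+1 by rewrite size_polyDl.
have [s Sr] := closed_field_poly_normal S.
have S0 : lead_coef S != 0 by rewrite lead_coef_eq0 -size_poly_eq0 sS.
have sr : size s = n.
  by move: sS; rewrite Sr size_scale// size_prod_XsubC => -[].
have mems z : (z \in s) = (T.[z] == w).
  by rewrite -subr_eq0 -root_prod_XsubC -(rootZ _ _ S0) -Sr rootE !hornerE.
exists (undup s); split; first exact: undup_uniq.
- by move=> z; rewrite mem_undup.
- by rewrite -sr size_undup.
rewrite (eq_count (a2 := [in s])) => [|z]; last by rewrite mems.
rewrite -sum_count_mem_undup -sum1_size -big_split /= -[leqLHS]sr.
have -> : size s = (\sum_(p <- undup s) count_mem p s)%N.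
  by rewrite sum_count_mem_undup; apply/esym/eqP; rewrite -all_count; apply/allP.
apply: leq_sum => p _; rewrite add1n -(mu_prod_XsubC p cr).
case E: (count_mem p s) => [//|k]; rewrite ltnS.
have l0 : lead_coef T^`() != 0 by rewrite lead_coef_eq0 deriv_neq0.
rewrite mup_geq; last by rewrite monic_neq0// monic_prod_XsubC.
rewrite -(dvdpZr _ _ l0) -Tcr (_ : T^`() = S^`()); last first.
  by rewrite derivB derivC subr0.
apply: dvdp_XsubC_deriv; rewrite Sr dvdpZr// -mup_geq.
  by rewrite mu_prod_XsubC E.
by rewrite monic_neq0// monic_prod_XsubC.
Qed.
End Ramification.

(** * Locally constant maps *)

Section Glue.
Variables (R : realType) (F : fieldType).

(** Closedness as a ball around each point of the complement, so that it can be
    combined directly with the radii of local constancy. *)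
Definition closed_normc (A : set R[i]) := forall z, ~ A z ->
  exists2 e : R, 0 < e & forall y, normc (y - z) < e -> ~ A y.

Definition locally_constant (U : Type) (A : set R[i]) (f : R[i] -> U) :=
  forall z, A z -> exists2 e : R, 0 < e &
    forall y, A y -> normc (y - z) < e -> f y = f z.

(** The values of [f] on [A] span the row space, in the dual form of having no
    common annihilator.  For a locally constant [f], a spanning map into
    dimension [d] is a way to say that [A] has at least [d] components. *)
Definition spanning (d : nat) (A : set R[i]) (f : R[i] -> 'rV[F]_d) :=
  forall v : 'cV[F]_d, (forall z, A z -> f z *m v = 0) -> v = 0.

(** The open set [O P] is the union of the balls on which [f] is constant with a
    value in [P].  It cuts out the preimage of [P], so each level set is
    relatively open, and also relatively closed since its complement has the
    same form. *)
Lemma connected_locally_constant (U : Type) (A : set R[i]^o) (f : R[i] -> U) :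
  connected A -> locally_constant A f -> forall x y, A x -> A y -> f x = f y.
Proof.
move=> cA fA x y Ax Ay.
pose O (P : set U) : set R[i]^o := [set z | exists u, [/\ A u, P (f u) &
  exists2 e : R, forall s, A s -> normc (s - u) < e -> f s = f u &
                 normc (z - u) < e]].
have opO P : open (O P).
  rewrite openE => z [u [Au Pu [e eu zu]]].
  apply/nbhs_normcP; exists (e - normc (z - u)); first by rewrite subr_gt0.
  move=> s sz; exists u; split=> //; exists e => //.
  by apply: le_lt_trans (normc_triangle s z u) _; rewrite -ltrBrDr.
have OE P z : A z -> O P z <-> P (f z).
  move=> Az; split=> [[u [Au Pu [e eu zu]]]|Pz]; first by rewrite (eu _ Az zu).
  exists z; split=> //; have [e e0 ez] := fA _ Az.
  by exists e => //; rewrite subrr normc0.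
have -> // : A `&` O [set f x] = A -> f x = f y.
  by move=> /seteqP[_ /(_ y Ay)[_ /(OE _ _ Ay)]].
apply: cA.
- by exists x; split=> //; apply/OE.
- by exists (O [set f x]).
- exists (~` O (~` [set f x])); first exact: open_closedC.
  apply/seteqP; split=> z [Az Oz]; split=> //.
    by move/(OE _ _ Az) : Oz => zx /(OE _ _ Az); apply.
  by apply/(OE _ _ Az); apply: contrapT => zx; apply: Oz; apply/(OE _ _ Az).
Qed.

(** Gluing two sets along a finite set of points [q] loses at most [size q]
    components.  The glued map takes its values in the quotient of the direct
    sum of the two target spaces by the relations that identify the two values
    at each point of [q]. *)
Lemma glue_spanning (A1 A2 : set R[i]) (k m : nat) (f1 : R[i] -> 'rV[F]_k)
    (f2 : R[i] -> 'rV[F]_m) (q : seq R[i]) :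
  closed_normc A1 -> closed_normc A2 ->
  locally_constant A1 f1 -> locally_constant A2 f2 ->
  spanning A1 f1 -> spanning A2 f2 ->
  (forall z, A1 z -> A2 z -> z \in q) ->
  exists d (f : R[i] -> 'rV[F]_d), [/\ locally_constant (A1 `|` A2) f,
    spanning (A1 `|` A2) f & (k + m <= d + size q)%N].
Proof.
move=> c1 c2 l1 l2 s1 s2 Aq.
(* The rows of [M] are the relations; [B] is the projection to the quotient,
   cut down to full column rank. *)
pose M := \matrix_(i < size q) row_mx (f1 q`_i) (- f2 q`_i).
pose B := col_base (cokermx M).
have MB z : A1 z -> A2 z -> row_mx (f1 z) 0 *m B = row_mx 0 (f2 z) *m B.
  move=> z1 z2; have zq := Aq _ z1 z2; apply/eqP.
  rewrite -subr_eq0 -mulmxBl opp_row_mx add_row_mx oppr0 addr0 add0r.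
  rewrite -(mulmx_free_eq0 _ (row_base_free (cokermx M))) -mulmxA mulmx_base.
  move: (zq); rewrite -index_mem => iz.
  have := congr1 (row (Ordinal iz)) (mulmx_coker M).
  by rewrite row_mul rowK row0 /= nth_index// => ->.
pose f z := if `[< A1 z >] then row_mx (f1 z) 0 *m B
            else row_mx 0 (f2 z) *m B.
have f1E z : A1 z -> f z = row_mx (f1 z) 0 *m B by move=> ?; rewrite /f asboolT.
have f2E z : A2 z -> f z = row_mx 0 (f2 z) *m B.
  by move=> z2; rewrite /f; case: asboolP => // z1; exact: MB.
have loc p (A : set R[i]) (g : R[i] -> 'rV[F]_p) (h : 'rV[F]_p -> _) z :
    closed_normc A -> locally_constant A g -> (forall z, A z -> f z = h (g z)) ->
    exists2 e : R, 0 < e & forall y, A y -> normc (y - z) < e -> f y = f z.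
  move=> cA gA fA; have [Az|nAz] := pselect (A z).
    by have [e e0 ge] := gA _ Az; exists e => // y Ay ?; rewrite !fA// ge.
  by have [e e0 ge] := cA _ nAz; exists e => // y Ay /ge.
exists _, f; split.
- move=> z _.
  have [e1 e10 E1] := loc _ _ _ (fun u => row_mx u 0 *m B) z c1 l1 f1E.
  have [e2 e20 E2] := loc _ _ _ (fun u => row_mx 0 u *m B) z c2 l2 f2E.
  exists (Num.min e1 e2); first by rewrite lt_min e10.
  by move=> y Ay; rewrite lt_min => /andP[y1 y2]; case: Ay => ?; [exact: E1|exact: E2].
- move=> v fv.
  have u1 : usubmx (B *m v) = 0.
    apply: s1 => z z1; have := fv z (or_introl z1).
    by rewrite f1E// -mulmxA -{1}[B *m v]vsubmxK mul_row_col mul0mx addr0.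
  have u2 : dsubmx (B *m v) = 0.
    apply: s2 => z z2; have := fv z (or_intror z2).
    by rewrite f2E// -mulmxA -{1}[B *m v]vsubmxK mul_row_col mul0mx add0r.
  have Bv : B *m v = 0 by rewrite -[B *m v]vsubmxK u1 u2 col_mx0.
  have /row_fullP[C CB] : row_full B by exact: col_base_full.
  by rewrite -[v]mul1mx -CB -mulmxA Bv mulmx0.
- rewrite mxrank_coker.
  have := rank_leq_row M; have := rank_leq_col M; lia.
Qed.

Lemma connected_spanning (d : nat) (A : set R[i]^o) (f : R[i] -> 'rV[F]_d) :
  connected A -> A !=set0 -> locally_constant A f -> spanning A f -> (d <= 1)%N.
Proof.
move=> cA [x Ax] lf sf.
have := mxrank_coker (f x); rewrite (_ : cokermx (f x) = 0).
  by rewrite mxrank0; have := rank_leq_row (f x); lia.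
apply/matrixP => i j; suff col0_ : col j (cokermx (f x)) = 0.
  by have := congr1 (fun u : 'cV_d => u i 0) col0_; rewrite !mxE.
apply: sf => z Az; rewrite (connected_locally_constant cA lf Az Ax).
by rewrite colE mulmxA mulmx_coker mul0mx.
Qed.
End Glue.

(** * Components over a segment *)

Lemma positive_lower_bound (R : realType) (s : seq R) :
  {in s, forall x, 0 < x} -> exists2 r : R, 0 < r & {in s, forall x, r <= x}.
Proof.
elim: s => [|a s IH] s0; first by exists 1.
have [|r r0 rs] := IH; first by move=> x xs; rewrite s0// inE xs orbT.
exists (Num.min a r); first by rewrite lt_min s0 ?mem_head.
by move=> x /predU1P[->|/rs]; rewrite ge_min ?lexx// => ->; rewrite orbT.
Qed.

Lemma normc_Re_Im (R : realType) (z : R[i]) :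
  complex.Re z <= normc z /\ `|complex.Im z| <= normc z.
Proof.
case: z => x y /=; split.
  rewrite (le_trans (ler_norm _))// -sqrtr_sqr ler_sqrt ?lerDl ?sqr_ge0//.
  by rewrite addr_ge0 ?sqr_ge0.
by rewrite -sqrtr_sqr ler_sqrt ?lerDr ?sqr_ge0// addr_ge0 ?sqr_ge0.
Qed.

Section Bands.
Variables (R : realType) (T : {poly R[i]}) (n : nat).
Hypotheses (hn : (0 < n)%N) (hT : size T = n.+1).

Definition band (s t : R) (z : R[i]) : bool :=
  (complex.Im T.[z] == 0) && (s <= complex.Re T.[z] <= t).

Lemma band_point (t : R) z : band t t z = (T.[z] == t%:C).
Proof.
by rewrite /band eq_complex /= [RHS]andbC -eq_le [t == _]eq_sym.
Qed.

Lemma bandU (s t u : R) : s <= t -> t <= u ->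
  [set` band s u] = [set` band s t] `|` [set` band t u].
Proof.
move=> st tu; apply/seteqP; split => z /=; rewrite /in_mem /= /band.
  by case: (_ == _) => //=; have := le_total t (complex.Re T.[z]); lra.
by case: (_ == _) => //=; lra.
Qed.

Lemma bandI (s t u : R) z : band s t z -> band t u z -> band t t z.
Proof. by rewrite /band; case: (_ == _) => //=; lra. Qed.

(** A condition defining the band that fails at a value fails on a ball around
    it, as real and imaginary parts are bounded by the modulus. *)
Lemma closed_band (s t : R) : closed_normc [set z | band s t z].
Proof.
move=> z /negP nz.
have [e e0 ez] : exists2 e : R, 0 < e &
    forall w, normc (w - T.[z]) < e ->
      ~~ ((complex.Im w == 0) && (s <= complex.Re w <= t)).
  move: nz; rewrite /band /=; case: T.[z] => x y /=.
  rewrite !negb_and -!ltNge => /or3P[y0|xs|tx].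
  - exists `|y|; first by rewrite normr_gt0.
    move=> [u v] /=; have [_] := normc_Re_Im (Complex u v - Complex x y).
    rewrite /= => h /(le_lt_trans h) uv; apply/negP => /andP[/eqP v0 _].
    by move: uv; rewrite v0 sub0r normrN ltxx.
  - exists (s - x); first by rewrite subr_gt0.
    move=> [u v]; have [+ _] := normc_Re_Im (Complex u v - Complex x y).
    move=> /= h /(le_lt_trans h) uv; rewrite !negb_and -!ltNge; apply/or3P.
    by apply: Or32; lra.
  - exists (x - t); first by rewrite subr_gt0.
    move=> [u v]; rewrite normcB.
    have [+ _] := normc_Re_Im (Complex x y - Complex u v).
    move=> /= h /(le_lt_trans h) uv; rewrite !negb_and -!ltNge; apply/or3P.
    by apply: Or33; lra.
have [d d0 dz] := poly_continuous T z e0.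
by exists d => // y /dz /ez /negP.
Qed.

Lemma lead_normc_gt0 : 0 < normc (lead_coef T).
Proof.
rewrite lt_neqAle normc_ge0 andbT eq_sym.
have : lead_coef T != 0 by rewrite lead_coef_eq0 -size_poly_eq0 hT.
by apply: contra_neq => /eq0_normc.
Qed.

(** A value within [|lead_coef T| * rho ^ n] of [w] is only taken within [rho] of
    a root of [T - w].  With [2 * rho] at most the distances between the roots,
    the balls of radius [rho] around the roots are disjoint, and their indicator
    functions are locally constant on the band. *)
Lemma band_clusters (w : R) (r : seq R[i]) :
  uniq r -> (forall z, (z \in r) = (T.[z] == w%:C)) ->
  exists2 d : R, 0 < d & forall s t, w - d < s -> s <= w -> w <= t -> t < w + d ->
  exists f : R[i] -> 'rV[R]_(size r),
    locally_constant [set z | band s t z] f /\ spanning [set z | band s t z] f.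
Proof.
move=> ur rE.
pose L := [seq normc (p.1 - p.2) / 2 | p <- [seq p <- allpairs pair r r | p.1 != p.2]].
have [|rho rho0 rhoL] := @positive_lower_bound R L.
  move=> _ /mapP[p + ->]; rewrite mem_filter => /andP[p12 _].
  rewrite divr_gt0// lt_neqAle normc_ge0 andbT eq_sym.
  by apply: contra_neq p12 => /eq0_normc/eqP; rewrite subr_eq0 => /eqP.
have sep z x y : x \in r -> y \in r -> normc (z - x) < rho ->
    normc (z - y) < rho -> x = y.
  move=> xr yr zx zy; apply: contrapT => /eqP xy.
  have : normc (x - y) / 2 \in L.
    by apply/mapP; exists (x, y) => //; rewrite mem_filter xy allpairs_f.
  move=> /rhoL; have := normcD (x - z) (z - y); rewrite addrA subrK (normcB x).
  lra.
have l0 := lead_normc_gt0.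
exists (normc (lead_coef T) * rho ^+ n); first by rewrite mulr_gt0 ?exprn_gt0.
move=> s t ws sw wt tw.
have near z : band s t z -> exists2 p, p \in r & normc (z - p) < rho.
  move=> /andP[/eqP I0 /andP[sz zt]].
  have [p pw pz] := root_near_small_value w%:C z hn hT.
  exists p; first by rewrite rE pw.
  have zw : normc (T.[z] - w%:C) < normc (lead_coef T) * rho ^+ n.
    have -> : T.[z] - w%:C = (complex.Re T.[z] - w)%:C.
      apply/eqP; rewrite eq_complex /= -I0.
      by case: T.[z] => x y /=; rewrite subr0 !eqxx.
    by rewrite normc_real ltr_norml; lra.
  move: (le_lt_trans pz zw); rewrite ltr_pM2l// ltr_pXn2r// nnegrE ?normc_ge0 ?ltW//.
pose f z : 'rV[R]_(size r) := \row_(i < size r) (normc (z - r`_i) < rho)%R%:R.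
exists f; split=> [z /near[p pr zp]|v fv].
  exists (rho - normc (z - p)); first by rewrite subr_gt0.
  move=> y _ yz; apply/rowP => i; rewrite !mxE.
  have yp : normc (y - p) < rho.
    by have := normcD (y - z) (z - p); rewrite addrA subrK; lra.
  have ri : r`_i \in r by rewrite mem_nth.
  congr (_%:R); congr nat_of_bool; apply/idP/idP => h.
    by rewrite -(sep _ _ _ pr ri yp h).
  by rewrite -(sep _ _ _ pr ri zp h).
apply/colP => i; have ri : r`_i \in r by rewrite mem_nth.
have : band s t r`_i.
  by move: ri; rewrite rE => /eqP; rewrite /band => -> /=; rewrite eqxx sw wt.
move=> /fv /matrixP /(_ 0 0); rewrite !mxE (bigD1 i)//= big1 => [|j ji].
  by rewrite mxE subrr normc0 rho0 mul1r addr0.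
rewrite mxE; case: ltP => [h|_]; last by rewrite mul0r.
have rj : r`_j \in r by rewrite mem_nth.
have ii : normc (r`_i - r`_i) < rho by rewrite subrr normc0.
have /eqP := sep _ _ _ rj ri h ii.
by rewrite nth_uniq// => /eqP/val_inj/eqP; rewrite (negbTE ji).
Qed.

Section Count.
Variable cr : seq R[i].
Hypothesis Tcr : T^`() = lead_coef T^`() *: \prod_(z <- cr) ('X - z%:P).

(** The map [f] certifies [d] components; the zeros of [T'], listed in [cr] with
    multiplicity, are the price of the components lost so far. *)
Definition many_components (t : R) : Prop :=
  exists d (f : R[i] -> 'rV[R]_d),
    [/\ locally_constant [set z | band (-1) t z] f,
        spanning [set z | band (-1) t z] f
      & (n <= d + count (band (-1) t) cr)%N].

Lemma count_band_leq (s t u : R) : s <= t -> t <= u ->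
  (count (band s t) cr <= count (band s u) cr)%N.
Proof.
move=> st tu; apply: sub_count => z /=.
by rewrite /band; case: (_ == _) => //=; lra.
Qed.

Lemma count_band_add (s t w u : R) : t < w -> w <= u -> s <= w ->
  (count (band s t) cr + count (fun z => T.[z] == w%:C) cr
     <= count (band s u) cr)%N.
Proof.
move=> tw wu sw; rewrite -count_predUI.
rewrite [X in (_ + X)%N](eq_count (a2 := pred0)); last first.
  move=> z /=; rewrite -band_point /band; case: (_ == _) => //=.
  by apply/negP => /andP[]; lra.
rewrite count_pred0 addn0; apply: sub_count => z /=.
by rewrite -band_point /band; case: (_ == _) => //=; lra.
Qed.

(** Over the point [-1] the inverse image is the finite fiber, and the claim is
    exactly the ramification count. *)
Lemma many_components_base : many_components (-1).
Proof.
have [r [ur rE _ nr]] := fiber_ramification hn hT (-1)%:C Tcr.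
have [d d0 /(_ (-1) (-1))[]] := band_clusters ur rE; try lra.
move=> f [lf sf]; exists _, f; split=> //.
by rewrite (eq_count (a2 := fun z => T.[z] == (-1)%:C)) => [//|z]; exact: band_point.
Qed.

(** The band over [[s, t]] is glued along the fiber over [s].  If [s < w] this
    fiber has at most [n] points and the critical points over [w] are new; if
    [s = w] it has exactly as many points as there are clusters, so nothing is
    lost. *)
Lemma many_components_step (w : R) : -1 <= w -> exists2 d : R, 0 < d &
  forall s t, -1 <= s -> w - d < s -> s <= w -> w <= t -> t < w + d ->
  many_components s -> many_components t.
Proof.
move=> w1; have [r [ur rE _ nr]] := fiber_ramification hn hT w%:C Tcr.
have [d d0 dP] := band_clusters ur rE.
exists d => // s t s1 ws sw wt tw [k [f1 [l1 p1 nk]]].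
have [f2 [l2 p2]] := dP s t ws sw wt tw.
have glue (q : seq R[i]) : (forall z, (z \in q) = (T.[z] == s%:C)) ->
    (n + size q <= k + size r + count (band (-1) t) cr)%N ->
    many_components t.
  move=> qE nq.
  have [||z z1 z2|m [f [lf pf km]]] := glue_spanning (q := q) _ _ l1 l2 p1 p2.
  - exact: closed_band.
  - exact: closed_band.
  - by rewrite qE -band_point; exact: bandI z1 z2.
  exists m, f; rewrite (bandU s1 (le_trans sw wt)); split=> //; lia.
have [sw'|ws'] := ltrP s w.
  have [q [_ qE sq _]] := fiber_ramification hn hT s%:C Tcr.
  apply: (glue q qE); apply: leq_trans (leq_add (leqnn n) sq) _.
  apply: leq_trans (leq_add nk nr) _.
  by rewrite addnACA leq_add2l (count_band_add sw' wt).
have sE : s = w by apply/eqP; rewrite eq_le sw.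
apply: (glue r); first by rewrite sE.
apply: leq_trans (leq_add nk (leqnn (size r))) _.
by rewrite addnAC leq_add2l (count_band_leq s1 (le_trans sw wt)).
Qed.

(** The supremum of the reachable [t] is 1, since the step lemma at the supremum
    crosses it from the left. *)
Lemma many_components_segment : many_components 1.
Proof.
pose S := [set t : R | -1 <= t <= 1 /\ many_components t].
have hS : has_sup S.
  split; last by exists 1 => t [/andP[]].
  by exists (-1); split; [lra|exact: many_components_base].
set m := sup S.
have m1 : -1 <= m.
  by apply: sup_upper_bound => //; split; [lra|exact: many_components_base].
have m2 : m <= 1 by apply: ge_sup; [case: hS|move=> t [/andP[]]].
have [d d0 dP] := many_components_step m1.
have [s [/andP[s1 s2] sP] ms] := sup_adherent d0 hS.
have sm : s <= m by apply: sup_upper_bound => //; split=> //; lra.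
have up t : m <= t -> t < m + d -> many_components t.
  by move=> mt tm; apply: (dP s t).
move: m2; rewrite le_eqVlt => /predU1P[m2|m2]; first by apply: up; lra.
pose t := Num.min 1 (m + d / 2).
have mt : m < t by rewrite lt_min m2/=; lra.
have t1 : t <= 1 by rewrite ge_min lexx.
have tm : t < m + d by rewrite gt_min; apply/orP; right; lra.
have : S t by split; [lra|apply: up => //; exact: ltW].
by move=> /(sup_upper_bound hS); rewrite leNgt mt.
Qed.
End Count.
End Bands.

(** * Topology of the plane *)

Lemma convex_lt (R : realType) (t x y c : R) : 0 <= t -> t <= 1 ->
  x < c -> y < c -> (1 - t) * x + t * y < c.
Proof.
move=> t0 t1 xc yc; have [->|t_neq0] := eqVneq t 0; first lra.
have : 0 < t by rewrite lt_neqAle eq_sym t_neq0.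
nra.
Qed.

Section Plane.
Variable R : realType.
Implicit Types (x y z : R[i]).

Lemma continuous_normcP (f : R[i]^o -> R) :
  (forall z (e : R), 0 < e -> exists2 d : R, 0 < d &
    forall y, normc (y - z) < d -> `|f y - f z| < e) -> continuous f.
Proof.
move=> fc z; apply/(@cvgrPdist_lt _ R^o _ _ (nbhs_filter (z : R[i]^o))) => e e0.
have [d d0 dz] := fc z e e0.
by apply/nbhs_normcP; exists d => // y /dz; rewrite distrC.
Qed.

Definition segment x y : set R[i]^o :=
  [set x + t%:C * (y - x) | t in `[0 : R, 1]].

Lemma segment_left x y : segment x y x.
Proof. by exists 0; rewrite /= ?in_itv /= ?lexx ?ler01// mul0r addr0. Qed.

Lemma segment_right x y : segment x y y.
Proof. by exists 1; rewrite /= ?in_itv /= ?lexx ?ler01// mul1r addrC subrK. Qed.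

Lemma continuous_line x y : continuous (fun t : R => x + t%:C * (y - x) : R[i]^o).
Proof.
move=> t A /nbhs_normcP[e e0 eA].
have k0 : 0 < normc (y - x) + 1 by rewrite ltr_wpDl ?normc_ge0.
apply/nbhs_ballP; exists (e / (normc (y - x) + 1)); first by rewrite /= divr_gt0.
move=> s; rewrite /ball /= ltr_pdivlMr// => ts; apply: eA.
have -> : x + s%:C * (y - x) - (x + t%:C * (y - x)) = (s - t)%:C * (y - x).
  by rewrite rmorphB /=; ring.
rewrite normcM normc_real distrC (le_lt_trans _ ts)// ler_wpM2l//.
by rewrite lerDl.
Qed.

Lemma compact_segment x y : compact (segment x y).
Proof.
apply: continuous_compact; last exact: segment_compact.
exact/continuous_subspaceT/continuous_line.
Qed.

Lemma connected_segment x y : connected (segment x y).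
Proof.
apply: connected_continuous_connected; first exact: segment_connected.
exact/continuous_subspaceT/continuous_line.
Qed.

Lemma segment_ball x y p (r : R) : normc (x - p) < r -> normc (y - p) < r ->
  forall z, segment x y z -> normc (z - p) < r.
Proof.
move=> xr yr z [t /=]; rewrite in_itv /= => /andP[t0 t1] <-.
have -> : x + t%:C * (y - x) - p = (1 - t)%:C * (x - p) + t%:C * (y - p).
  by rewrite rmorphB rmorph1 /=; ring.
apply: (le_lt_trans (normcD _ _)); rewrite !normcM !normc_real.
rewrite !ger0_norm ?subr_ge0//; exact: convex_lt.
Qed.

(** The plane is the continuous image of the product of two lines, where closed
    rectangles are compact. *)
Lemma closed_bounded_compact (A : set R[i]^o) (M : R) :
  closed A -> (forall z, A z -> normc z <= M) -> compact A.
Proof.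
move=> cA AM.
pose f (p : R * R) : R[i]^o := p.1 +i* p.2.
have fc : continuous f.
  move=> [u v] B /nbhs_normcP[e e0 eB].
  apply/nbhs_ballP; exists (e / 2); first by rewrite /= divr_gt0.
  move=> [s t] [/=]; rewrite /ball /= => us vt; apply: eB.
  have -> : f (s, t) - f (u, v) = (s - u)%:C + 'i * (t - v)%:C.
    by rewrite /f /=; simpc.
  apply: (le_lt_trans (normcD _ _)); rewrite normcM !normc_real.
  have -> : normc 'i = 1 :> R by rewrite /= expr0n expr1n add0r sqrtr1.
  rewrite mul1r distrC [`|t - v|]distrC; lra.
apply: (@subclosed_compact _ A (f @` (`[-M, M] `*` `[-M, M]))) => //.
  apply: continuous_compact; first exact/continuous_subspaceT.
  by apply: compact_setX; exact: segment_compact.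
move=> z /AM zM; exists (complex.Re z, complex.Im z); last by case: z {zM}.
have [r1 r2] := normc_Re_Im z; have [r3 _] := normc_Re_Im (- z).
rewrite normc_opp in r3; rewrite /= !in_itv /= -!ler_norml (le_trans r2)//.
split=> //; rewrite ler_norml; have : complex.Re (- z) = - complex.Re z by case: (z).
lra.
Qed.

(** Around each point of one set take half the radius of a ball missing the other
    set; two such balls from different sets cannot meet. *)
Lemma disjoint_open_neighborhoods (A B : set R[i]^o) :
  closed A -> closed B -> A `&` B = set0 ->
  exists U V : set R[i]^o, [/\ open U, open V, A `<=` U, B `<=` V & U `&` V = set0].
Proof.
move=> cA cB AB.
pose O (C D : set R[i]^o) : set R[i]^o := [set z | exists x (e : R), [/\ C x,
  forall y, normc (y - x) < e -> ~ D y & normc (z - x) < e / 2]].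
have oO C D : open (O C D).
  rewrite openE => z [x [e [Cx eD zx]]].
  apply/nbhs_normcP; exists (e / 2 - normc (z - x)); first by rewrite subr_gt0.
  move=> y yz; exists x, e; split=> //.
  by apply: le_lt_trans (normc_triangle y z x) _; rewrite -ltrBrDr.
have subO (C D : set R[i]^o) : closed D -> C `&` D = set0 -> C `<=` O C D.
  move=> cD CD x Cx; have /nbhs_normcP[e e0 eD] : nbhs (x : R[i]^o) (~` D).
    apply: open_nbhs_nbhs; split; first exact: closed_openC.
    by move=> Dx; have : (C `&` D) x by []; rewrite CD.
  by exists x, e; split=> //; rewrite subrr normc0 divr_gt0.
exists (O A B), (O B A); split=> //; first exact: subO.
  by apply: subO; rewrite // setIC.
apply/seteqP; split=> // z [[x [e [Ax eB zx]]] [y [d [By dA zy]]]].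
have xy : normc (y - x) < e / 2 + d / 2.
  by apply: le_lt_trans (normc_triangle y z x) _; rewrite addrC normcB ltrD 1?normcB.
have [ed|de] := leP d e; first by apply: (eB y _ By); apply: (lt_le_trans xy); lra.
by apply: (dA x _ Ax); rewrite normcB; apply: (lt_trans xy); lra.
Qed.

End Plane.

(** * The sum of the distances to the foci *)

(** The equality case of the triangle inequality in coordinates: [a] and [b] are
    the distances from [(x, y)] to [(1, 0)] and [(-1, 0)]. *)
Lemma focal_sum_arith (R : realType) (a b x y : R) : 0 <= a -> 0 <= b ->
  a ^+ 2 = (x - 1) ^+ 2 + y ^+ 2 -> b ^+ 2 = (x + 1) ^+ 2 + y ^+ 2 ->
  2 <= a + b -> (a + b <= 2) = (y == 0) && (-1 <= x <= 1).
Proof.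
move=> a0 b0 a2 b2 ab; apply/idP/andP => [ab2|[/eqP y0 /andP[x1 x2]]].
  have bE : b = 2 - a by lra.
  have aE : a = 1 - x by rewrite bE in b2; lra.
  have y0 : y ^+ 2 = 0 by rewrite aE in a2; lra.
  by rewrite -sqrf_eq0 y0 eqxx; split=> //; lra.
rewrite y0 in a2 b2.
have aE : a = 1 - x by apply: (@pexpIrn _ 2); rewrite ?nnegrE//; lra.
have bE : b = 1 + x by apply: (@pexpIrn _ 2); rewrite ?nnegrE//; lra.
lra.
Qed.

Section Levels.
Variables (R : realType) (T : {poly R[i]}) (n : nat).
Hypotheses (hn : (0 < n)%N) (hT : size T = n.+1).

(** The level sets are the preimages of the confocal ellipses with foci [-1] and
    [1], the segment being the degenerate one at level 2. *)
Definition focal_sum (z : R[i]) : R := normc (T.[z] - 1) + normc (T.[z] + 1).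
Local Notation G := focal_sum.

Lemma focal_sum_ge2 z : 2 <= G z.
Proof.
have := normcD (T.[z] + 1) (- (T.[z] - 1)); rewrite normc_opp.
have -> : T.[z] + 1 - (T.[z] - 1) = (2 : R)%:C.
  by rewrite (_ : 2 = 1 + 1 :> R)// rmorphD/=; ring.
by rewrite normc_real normr_nat addrC.
Qed.

Lemma focal_sum_le2 z : (G z <= 2) = band T (-1) 1 z.
Proof.
have := focal_sum_ge2 z; rewrite /G /band; case: T.[z] => x y.
have a0 := normc_ge0 (x +i* y - 1); have b0 := normc_ge0 (x +i* y + 1).
have a2 : normc (x +i* y - 1) ^+ 2 = (x - 1) ^+ 2 + y ^+ 2.
  by rewrite /= sqr_sqrtr ?addr_ge0 ?sqr_ge0// subr0.
have b2 : normc (x +i* y + 1) ^+ 2 = (x + 1) ^+ 2 + y ^+ 2.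
  by rewrite /= sqr_sqrtr ?addr_ge0 ?sqr_ge0// addr0.
exact: focal_sum_arith.
Qed.

Lemma focal_sum_lipschitz y z : `|G y - G z| <= 2 * normc (T.[y] - T.[z]).
Proof.
have l (s : R[i]) : `|normc (T.[y] + s) - normc (T.[z] + s)| <= normc (T.[y] - T.[z]).
  have := normc_triangle (T.[y] + s) (T.[z] + s) 0.
  have := normc_triangle (T.[z] + s) (T.[y] + s) 0.
  rewrite !subr0 (normcB (T.[z] + s)) opprD addrACA subrr addr0.
  rewrite ler_norml; lra.
have := l 1; have := l (- 1); rewrite /G !ler_norml; lra.
Qed.

Lemma focal_sum_near z (e : R) : 0 < e -> exists2 d : R, 0 < d &
  forall y, normc (y - z) < d -> `|G y - G z| < e.
Proof.
move=> e0; have [d d0 dz] := poly_continuous T z (divr_gt0 e0 (ltr0Sn R 1)).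
exists d => // y /dz yz; apply: le_lt_trans (focal_sum_lipschitz y z) _; lra.
Qed.

Lemma continuous_focal_sum : continuous (G : R[i]^o -> R).
Proof. by apply: continuous_normcP => z e; exact: focal_sum_near. Qed.

Lemma closed_sublevel (c : R) : closed [set z : R[i]^o | G z <= c].
Proof.
rewrite (_ : [set _ | _] = G @^-1` [set s | s <= c]); last by [].
by apply: preimage_closed; [move=> z _; exact: continuous_focal_sum|exact: closed_le].
Qed.

(** A bound on [T z] bounds the distance from [z] to the nearest root of [T]. *)
Lemma compact_sublevel (c : R) : compact [set z : R[i]^o | G z <= c].
Proof.
have [r rE] := closed_field_poly_normal T.
have l0 := lead_normc_gt0 hT.
have rmem p : T.[p] = 0 -> p \in r.
  move=> p0; rewrite -root_prod_XsubC -(@rootZ _ _ (lead_coef T)) -?rE ?rootE ?p0//.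
  by rewrite lead_coef_eq0 -size_poly_eq0 hT.
pose M := \sum_(p <- r) normc p.
have rM p : p \in r -> normc p <= M.
  by move=> pr; rewrite /M (big_rem p)//= lerDl sumr_ge0// => q _; exact: normc_ge0.
pose k := normc (lead_coef T).
apply: (@closed_bounded_compact _ _ (M + Num.max 1 (c / k))).
  exact: closed_sublevel.
move=> z /= Gz.
have [p /rmem/rM pM pz] := root_near_small_value 0 z hn hT.
have Tz : normc T.[z] <= c.
  have := normc_triangle (T.[z] - 1) 0 (T.[z] + 1).
  have := normc_triangle T.[z] 1 0; have := normc_triangle T.[z] (-1) 0.
  have := focal_sum_ge2 z.
  rewrite !subr0 !opprK normc_opp normc1; move: Gz; rewrite /G.
  have := normcD (T.[z] - 1) (T.[z] + 1).
  have -> : T.[z] - 1 + (T.[z] + 1) = (2 : R)%:C * T.[z].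
    by rewrite (_ : 2 = 1 + 1 :> R)// rmorphD/=; ring.
  by rewrite normcM normc_real normr_nat; lra.
rewrite -[z](subrK p) (le_trans (normcD _ _))// addrC lerD//.
rewrite le_max; have [//|z1 /=] := leP (normc (z - p)) 1.
rewrite ler_pdivlMr// mulrC (le_trans _ Tz)//.
rewrite subr0 in pz; apply: le_trans pz; apply: ler_wpM2l; first exact: ltW.
by rewrite ler_eXnr ?ltW.
Qed.

(** Along [d], chosen with [T' p * d = - T p], the value [T (x + t d)] is
    [(1 - t) T x] up to an error small compared with [t].  By convexity the focal
    sum is then at most [(1 - t) * G x + 2 * t] up to such an error, and
    [(G p + 2) / 2] leaves room for it. *)
Lemma focal_sum_descent p : 2 < G p -> T^`().[p] != 0 ->
  exists (d : R[i]) (r t0 : R), [/\ 0 < r, 0 < t0, t0 <= 1 &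
    forall x t, normc (x - p) < r -> 0 <= t -> t <= t0 ->
      G (x + t%:C * d) <= (1 - t) * G x + t * ((G p + 2) / 2)].
Proof.
move=> Gp kn0; set k := T^`().[p] in kn0.
pose w := T.[p]; pose d := - w / k; pose D := normc d.
have D0 : 0 <= D by exact: normc_ge0.
pose eta := (G p - 2) / 8; have eta0 : 0 < eta by rewrite /eta; lra.
have eD0 : 0 < eta / (D + 1) by rewrite divr_gt0//; lra.
have eDE : eta / (D + 1) * D <= eta.
  by rewrite mulrAC ler_pdivrMr; [nra|lra].
have [d1 d10 H1] := poly_strict_derivative T p eD0.
have [d2 d20 H2] := poly_continuous T p eta0.
pose r := Num.min d1 d2 / 2.
have m0 : 0 < Num.min d1 d2 by rewrite lt_min d10.
have r0 : 0 < r by rewrite divr_gt0.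
have rd1 : 2 * r <= d1 by rewrite /r mulrC divfK// ge_min lexx.
have rd2 : 2 * r <= d2 by rewrite /r mulrC divfK// ge_min lexx orbT.
have t0D : 0 < r / (D + 1) by rewrite divr_gt0//; lra.
exists d, r, (Num.min 1 (r / (D + 1))); split=> //.
- by rewrite lt_min ltr01.
- by rewrite ge_min lexx.
move=> x t xp t0; rewrite le_min => /andP[t1]; rewrite ler_pdivlMr; last by lra.
move=> tD; set y := x + t%:C * d.
have yx : normc (y - x) = t * D by rewrite /y addrC addKr normcM normc_real ger0_norm.
have yp : normc (y - p) < d1.
  by apply: le_lt_trans (normc_triangle y x p) _; rewrite yx; lra.
have xp1 : normc (x - p) < d1 by lra.
have xp2 : normc (x - p) < d2 by lra.
have Tx := H2 _ xp2.
have := H1 _ _ yp xp1; rewrite yx -/k; set e := _ - _ => He.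
have {}He : normc e <= t * eta by apply: le_trans He _; nra.
have TyE : T.[y] = T.[x] - t%:C * w + e.
  have -> : e = T.[y] - T.[x] - k * (t%:C * d) by rewrite /e {2}/y [x + _]addrC addrK.
  by rewrite /d; field.
have bound s : normc s = 1 ->
    normc (T.[y] + s) <= (1 - t) * normc (T.[x] + s) + t + 2 * t * eta.
  move=> s1.
  have -> : T.[y] + s =
      (1 - t)%:C * (T.[x] + s) + (t%:C * s + (t%:C * (T.[x] - w) + e)).
    by rewrite TyE rmorphB rmorph1 /=; ring.
  have := normcD ((1 - t)%:C * (T.[x] + s)) (t%:C * s + (t%:C * (T.[x] - w) + e)).
  have := normcD (t%:C * s) (t%:C * (T.[x] - w) + e).
  have := normcD (t%:C * (T.[x] - w)) e.
  rewrite !normcM !normc_real s1 !ger0_norm ?subr_ge0//.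
  have : t * normc (T.[x] - w) <= t * eta by apply: ler_wpM2l => //; exact: ltW.
  lra.
have := bound 1 (normc1 R); have := bound (- 1).
rewrite normc_opp normc1 => /(_ erefl); rewrite /eta /G; lra.
Qed.
End Levels.

(** * Mountain pass *)

Section MountainPass.
Variables (R : realType) (T : {poly R[i]}) (n : nat).
Hypotheses (hn : (0 < n)%N) (hT : size T = n.+1).
Local Notation G := (focal_sum T).

(** Continua rather than paths: they can be concatenated by mere union, and
    compactness lowers the level below which they stay. *)
Definition joined (c : R) (x y : R[i]) : Prop := exists C : set R[i]^o,
  [/\ compact C, connected C, C x, C y & forall z, C z -> G z < c].

Lemma joined_sym c x y : joined c x y -> joined c y x.
Proof. by move=> [C [cC kC Cx Cy Cc]]; exists C. Qed.

Lemma joined_trans c y x z : joined c x y -> joined c y z -> joined c x z.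
Proof.
move=> [C [cC kC Cx Cy Cc]] [D [cD kD Dy Dz Dc]]; exists (C `|` D); split.
- exact: compactU.
- by apply: connectedU => //; exists y.
- by left.
- by right.
- by move=> s [/Cc|/Dc].
Qed.

Lemma joined_le c c' x y : c <= c' -> joined c x y -> joined c' x y.
Proof.
move=> cc' [C [cC kC Cx Cy Cc]]; exists C; split=> // z /Cc.
by move=> /lt_le_trans; apply.
Qed.

Lemma joined_segment c x y :
  (forall z, segment x y z -> G z < c) -> joined c x y.
Proof.
exists (segment x y); split=> //; [exact: compact_segment|
  exact: connected_segment|exact: segment_left|exact: segment_right].
Qed.

(** [G] attains its maximum on the continuum. *)
Lemma joined_lower c x y : joined c x y -> exists2 c', c' < c & joined c' x y.
Proof.
move=> [C [cC kC Cx Cy Cc]].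
have [|m mC mG] := compact_EVT_max _ cC
    (continuous_subspaceT (@continuous_focal_sum _ T)).
  by exists x.
have Gm : G m < c by apply: Cc; rewrite inE in mC.
exists ((G m + c) / 2); first lra.
exists C; split=> // z Cz; have := mG z; rewrite inE => /(_ Cz); lra.
Qed.

Lemma joined_large x y : exists2 c, 2 < c & joined c x y.
Proof.
have [|m _ mG] := compact_EVT_max _ (@compact_segment _ x y)
    (continuous_subspaceT (@continuous_focal_sum _ T)).
  by exists x; exact: segment_left.
exists (G m + 1); first by have := focal_sum_ge2 T m; lra.
apply: joined_segment => z xyz; have := mG z; rewrite inE => /(_ xyz); lra.
Qed.

(** Below level [c], two points near [p] slide along the descent direction to
    points whose whole connecting segment is below [c]: near [p + t0 d] the
    function [G] is less than [c] by a margin independent of the two points. *)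
Lemma joined_locally c p : 2 < c -> G p <= c -> (G p = c -> T^`().[p] != 0) ->
  exists2 r : R, 0 < r & forall x y, normc (x - p) < r -> normc (y - p) < r ->
    G x < c -> G y < c -> joined c x y.
Proof.
move=> c2; rewrite le_eqVlt => /predU1P[pc /(_ pc) Tp|pc _]; last first.
  have pc0 : 0 < c - G p by rewrite subr_gt0.
  have [r r0 rG] := focal_sum_near T p pc0.
  exists r => // x y xr yr _ _; apply: joined_segment => z /(segment_ball xr yr) /rG.
  by rewrite ltr_norml; lra.
have p2 : 2 < G p by rewrite pc.
have [d [r [t0 [r0 t00 t01 desc]]]] := focal_sum_descent p2 Tp.
rewrite pc in desc.
have e0 : 0 < t0 * (c - 2) / 4 by rewrite divr_gt0// mulr_gt0// subr_gt0.
have [s s0 sG] := focal_sum_near T p e0.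
exists (Num.min r s) => [|x y]; first by rewrite lt_min r0.
rewrite !lt_min => /andP[xr xs] /andP[yr ys] Gx Gy.
have slide z : normc (z - p) < r -> G z < c -> joined c z (z + t0%:C * d).
  move=> zr Gz; apply: joined_segment => _ [t /= + <-].
  rewrite in_itv /= => /andP[ta tb].
  have -> : z + t%:C * (z + t0%:C * d - z) = z + (t * t0)%:C * d.
    by rewrite rmorphM /=; ring.
  have u0 : 0 <= t * t0 by rewrite mulr_ge0// ltW.
  have u1 : t * t0 <= t0 by rewrite ler_piMl// ltW.
  apply: le_lt_trans (desc _ _ zr u0 u1) _; apply: convex_lt => //; lra.
apply: joined_trans (slide x xr Gx) _.
apply: (@joined_trans _ (y + t0%:C * d)); last exact/joined_sym/slide.
apply: joined_segment => _ [t /= tI <-].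
pose z := x + t%:C * (y - x).
have xyz : segment x y z by exists t.
have -> : x + t0%:C * d + t%:C * (y + t0%:C * d - (x + t0%:C * d)) = z + t0%:C * d.
  by rewrite /z; ring.
have zr := segment_ball xr yr xyz; have /sG := segment_ball xs ys xyz.
rewrite pc ltr_norml => /andP[_ zs].
apply: le_lt_trans (desc _ _ zr (ltW t00) (lexx _)) _; nra.
Qed.

(** A point of level [c] that is not critical is not a local minimum, as the
    descent direction shows. *)
Lemma sublevel_dense c p : 2 < c -> G p <= c -> (G p = c -> T^`().[p] != 0) ->
  closure [set z : R[i]^o | G z < c] p.
Proof.
move=> c2; rewrite le_eqVlt => /predU1P[pc /(_ pc) Tp|pc _]; last first.
  exact: subset_closure.
have p2 : 2 < G p by rewrite pc.
have [d [r [t0 [r0 t00 t01 desc]]]] := focal_sum_descent p2 Tp.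
move=> B /nbhs_normcP[e e0 eB].
have k0 : 0 < normc d + 1 by rewrite ltr_wpDl ?normc_ge0.
pose t := Num.min t0 (e / (normc d + 1) / 2).
have t_gt0 : 0 < t by rewrite lt_min t00 !divr_gt0.
have tt0 : t <= t0 by rewrite ge_min lexx.
exists (p + t%:C * d); split => /=.
  have pr : normc (p - p) < r by rewrite subrr normc0.
  apply: le_lt_trans (desc _ _ pr (ltW t_gt0) tt0) _; rewrite pc; nra.
apply: eB; rewrite addrC addKr normcM normc_real gtr0_norm//.
have te : t <= e / (normc d + 1) / 2 by rewrite ge_min lexx orbT.
rewrite -mulrA mulrC -mulrA ler_pdivlMl// in te.
have : 0 <= normc d by exact: normc_ge0.
nra.
Qed.

(** The two closed pieces have disjoint open neighborhoods [U] and [V].  On the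
    compact part of [{G <= c + 1}] outside both, [G] has a minimum greater than
    [c]; below it, a connected set meeting [U] stays in [U]. *)
Lemma separated_above (c : R) (A B : set R[i]^o) a b :
  [set z | G z <= c] = A `|` B -> closed A -> closed B -> A `&` B = set0 ->
  A a -> B b -> exists2 c', c < c' & ~ joined c' a b.
Proof.
move=> GAB cA cB AB Aa Bb.
have [U [V [oU oV AU BV UV]]] := disjoint_open_neighborhoods cA cB AB.
have [c' cc' c'UV] : exists2 c', c < c' & forall z, G z < c' -> U z \/ V z.
  pose L := [set z : R[i]^o | G z <= c + 1] `&` ~` (U `|` V).
  have [L0|/set0P L0] := eqVneq L set0.
    exists (c + 1); first by rewrite ltrDl.
    move=> z zc; apply: contrapT => nUV; have : L z by split=> //=; exact: ltW.
    by rewrite L0.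
  have cL : compact L.
    apply: compact_closedI; first exact: (compact_sublevel hn hT).
    exact/open_closedC/openU.
  have [m mL mG] := compact_EVT_min L0 cL
    (continuous_subspaceT (@continuous_focal_sum _ T)).
  have cm : c < G m.
    rewrite ltNge; apply/negP => mc; rewrite inE in mL; case: mL => _; apply.
    have : (A `|` B) m by rewrite -GAB.
    by case=> [/AU|/BV]; [left|right].
  exists (Num.min (G m) (c + 1)); first by rewrite lt_min cm ltrDl ltr01.
  move=> z; rewrite lt_min => /andP[zm zc]; apply: contrapT => nUV.
  have : L z by split=> //=; exact: ltW.
  by rewrite -inE => /mG; rewrite leNgt zm.
exists c' => // -[C [_ kC Ca Cb Cc]].
have CU : C `&` U = C.
  apply: kC; [by exists a; split=> //; exact: AU|by exists U|].
  exists (~` V); first exact: open_closedC.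
  apply/seteqP; split=> z [Cz zU]; split=> //.
    by move=> zV; have : (U `&` V) z by []; rewrite UV.
  by have [|//] := c'UV _ (Cc _ Cz).
have [_ Ub] : (C `&` U) b by rewrite CU.
by have : (U `&` V) b by [split=> //; exact: BV]; rewrite UV.
Qed.

Hypothesis crit : forall z, root T^`() z -> G z <= 2.

(** Otherwise the points of [{G < c}] that are joined to [a] and those that are
    not would have disjoint closures, by local connectedness at every point of
    level at most [c], and these cover the closed sublevel set by density; so
    [a] and [b] would remain separated above [c]. *)
Lemma joined_limit (c : R) (a b : R[i]) : 2 < c -> G a < c -> G b < c ->
  (forall c', c < c' -> joined c' a b) -> joined c a b.
Proof.
move=> c2 ac bc above; apply: contrapT => nab.
have reg z : G z = c -> T^`().[z] != 0.
  by move=> zc; apply/negP => /crit; rewrite zc leNgt c2.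
pose V := [set z : R[i]^o | G z < c /\ joined c a z].
pose W := [set z : R[i]^o | G z < c /\ ~ joined c a z].
have sub (X : set R[i]^o) : (X `<=` [set z | G z < c]) ->
    closure X `<=` [set z | G z <= c].
  move=> Xc z zX; apply: (@closed_sublevel _ T c).
  by apply: (closureS _ zX) => s /Xc /ltW.
have [c' cc' nc'] : exists2 c', c < c' & ~ joined c' a b.
  apply: (@separated_above c (closure V) (closure W)).
  - apply/seteqP; split=> [z zc|z [|]]; last 2 first.
    + by apply: sub => s [].
    + by apply: sub => s [].
    have := sublevel_dense c2 zc (reg z); rewrite -closureU.
    apply: closureS => s sc; have [|] := pselect (joined c a s); by [left|right].
  - exact: closed_closure.
  - exact: closed_closure.
  - apply/seteqP; split=> // z [zV zW].
    have zc : G z <= c by apply: sub zV => s [].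
    have [r r0 rP] := joined_locally c2 zc (reg z).
    have nr : nbhs (z : R[i]^o) [set y | normc (y - z) < r].
      by apply/nbhs_normcP; exists r.
    have [v [[vc av] vz]] := zV _ nr; have [w [[wc aw] wz]] := zW _ nr.
    by apply: aw; apply: joined_trans av _; exact: rP.
  - apply: subset_closure; split=> //; apply: joined_segment => _ [t _ <-].
    by rewrite subrr mulr0 addr0.
  - exact: subset_closure.
exact/nc'/above.
Qed.

(** The infimum of the levels below which [a] and [b] are joined would be greater
    than 2 and attained, but joined points are joined at a lower level. *)
Lemma connected_of_critical_points :
  connected [set z : R[i]^o | G z <= 2].
Proof.
apply: contrapT => /connectedPn[E [E0 KE [sep1 sep2]]].
have cl b : closed (E b).
  move=> z zE.
  have Kz : (E false `|` E true) z.
    rewrite -KE; apply: (@closed_sublevel _ T 2); apply: (closureS _ zE) => s Es.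
    by rewrite KE; case: (b) Es => Es; [right|left].
  case: b zE => zE; case: Kz => // Ez.
    have : (E false `&` closure (E true)) z by [].
    by rewrite sep2.
  have : (closure (E false) `&` E true) z by [].
  by rewrite sep1.
have [a Ea] := E0 false; have [b Eb] := E0 true.
have a2 : G a <= 2 by have : (E false `|` E true) a by [left]; rewrite -KE.
have b2 : G b <= 2 by have : (E false `|` E true) b by [right]; rewrite -KE.
have EE : E false `&` E true = set0.
  apply/seteqP; split=> // z [z0 z1]; rewrite -sep1; split=> //.
  exact: subset_closure.
have [c0 c02 nc0] := separated_above KE (cl false) (cl true) EE Ea Eb.
pose S := [set c | joined c a b].
have [k _ Sk] := joined_large a b.
have lb : lbound S c0.
  move=> c Sc; rewrite leNgt; apply/negP => cc0; apply: nc0.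
  by apply: joined_le Sc; exact: ltW.
have hS : has_inf S by split; [exists k|exists c0].
have m2 : 2 < inf S.
  by apply: lt_le_trans c02 _; apply: lb_le_inf => //; exists k.
have Sm : S (inf S).
  apply: joined_limit => //; [exact: le_lt_trans m2|exact: le_lt_trans m2|].
  move=> c mc; have [s Ss sc] := inf_lt (ex_intro _ k Sk) mc.
  by apply: joined_le Ss; exact: ltW.
have [c' c'm Sc'] := joined_lower Sm.
have : inf S <= c' by apply: ge_inf => //; exists c0.
by rewrite leNgt c'm.
Qed.
End MountainPass.

(** * Connectedness and critical points *)

(* [size T = n.+1] says that T has degree exactly n. *)
Theorem theorem4 (R : realType) (n : nat) (hn : (1 <= n)%N)
    (T : {poly R[i]}) (hT : size T = n.+1) :
  connected (inverse_image T) <->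
  (forall z : R[i], root T^`() z -> inverse_image T z).
Proof.
have KE : inverse_image T = [set z : R[i]^o | band T (-1) 1 z].
  apply/seteqP; split=> z /=.
    by move=> [t]; rewrite /= in_itv /band /= => t1 <- /=; rewrite eqxx.
  move=> /andP[/eqP I0 r1]; exists (complex.Re T.[z]); first by rewrite /= in_itv.
  by apply/eqP; rewrite eq_complex /= I0 !eqxx.
split=> [cK z z0|crit]; rewrite KE; last first.
  rewrite (_ : [set _ | _] = [set z : R[i]^o | focal_sum T z <= 2]).
    apply: (connected_of_critical_points hn hT) => z /crit.
    by rewrite KE /= focal_sum_le2.
  by apply/seteqP; split=> z /=; rewrite focal_sum_le2.
(* Connectedness allows only one component, which leaves no critical point
   outside the band. *)
have [cr Tcr] := closed_field_poly_normal T^`().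
have [d [f [lf sf nd]]] := many_components_segment hn hT Tcr.
have l0 : lead_coef T^`() != 0 by rewrite lead_coef_eq0 (deriv_neq0 hn hT).
have scr : (size cr < n)%N.
  have := lt_size_deriv (p := T); rewrite -size_poly_eq0 hT => /(_ isT).
  by rewrite Tcr size_scale// size_prod_XsubC.
have d1 : (d <= 1)%N.
  rewrite KE in cK; apply: connected_spanning cK _ lf sf.
  have [p pE] : exists p, root T p by apply/closed_rootP; rewrite hT; lia.
  exists p; rewrite /= /band (rootP pE) /=; rewrite eqxx; lra.
have : all (band T (-1) 1) cr.
  rewrite all_count eqn_leq count_size /= -ltnS.
  by apply: leq_trans scr (leq_trans nd _); rewrite -add1n leq_add2r.
by move=> /allP; apply; rewrite -root_prod_XsubC -(rootZ _ _ l0) -Tcr.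
Qed.
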